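(* If a real Banach space $X$ is uniformly alternatively convex or smooth (uacs), then $X$ has the anti-Daugavet property.
   Context: A Banach space $X$ has the anti-Daugavet property if, for every bounded linear operator $T\colon X\to X$, the equivalence $$\|\mathrm{Id}+T\|=1+\|T\| \iff \|T\|\in\sigma(T)$$ holds, where $\sigma(T)$ denotes the spectrum of $T$ (so, for a real number $\lambda$, $\lambda\in\sigma(T)$ means that $\lambda\,\mathrm{Id}-T$ is not invertible in $L(X)$). $S_X$ and $S_{X^*}$ are the unit spheres of $X$ and of its dual. $X$ is uniformly alternatively convex or smooth (uacs) if for all sequences $(x_n),(y_n)$ in $S_X$ and $(x_n^* )$ in $S_{X^*}$ the implication $$x_n^*(x_n)\to 1,\ \|x_n+y_n\|\to 2 \ \Rightarrow\ x_n^*(y_n)\to 1$$ holds. *)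

(* Defs.v *)
From HB Require Import structures.
From mathcomp Require Import all_boot all_order all_algebra.
From mathcomp Require Import all_classical all_reals all_analysis.

Set Implicit Arguments.
Unset Strict Implicit.
Unset Printing Implicit Defensive.

Import Order.TTheory GRing.Theory Num.Theory.
Import numFieldNormedType.Exports.

Local Open Scope classical_set_scope.
Local Open Scope ring_scope.

(* The supremum runs over the closed unit ball, so that the value is also
   right (namely 0) on the zero space.  Since [sup] is total, [opnorm f] is
   only meaningful when [f] is bounded on the unit ball. *)
Definition opnorm (R : realType) (V W : normedModType R) (f : V -> W) : R :=
  sup [set `|f x| | x in [set x : V | `|x| <= 1]].

(* Invertibility in the algebra L(X): the two-sided inverse is required to be
   linear and bounded. *)
Definition op_invertible (R : realType) (X : normedModType R) (A : X -> X) :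
    Prop :=
  exists S : {linear X -> X}, [/\ bounded_fun_norm S, cancel A S & cancel S A].

(* Spectrum over the real scalars; no complexification is involved. *)
Definition spectrum (R : realType) (X : normedModType R) (T : X -> X) : set R :=
  [set lambda : R | ~ op_invertible (fun x => lambda *: x - T x)].

Definition anti_Daugavet (R : realType) (X : normedModType R) : Prop :=
  forall T : {linear X -> X}, bounded_fun_norm T ->
    (opnorm (fun x => x + T x) = 1 + opnorm T <-> spectrum T (opnorm T)).

Definition unit_sphere (R : realType) (X : normedModType R) : set X :=
  [set x : X | `|x| = 1].

Definition dual_unit_sphere (R : realType) (X : normedModType R) :
    set {linear X -> R^o} :=
  [set phi : {linear X -> R^o} | bounded_fun_norm phi /\ opnorm phi = 1].

Definition uacs (R : realType) (X : normedModType R) : Prop :=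
  forall (x y : nat -> X) (phi : nat -> {linear X -> R^o}),
    (forall n, unit_sphere (x n)) -> (forall n, unit_sphere (y n)) ->
    (forall n, dual_unit_sphere (phi n)) ->
    phi n (x n) @[n --> \oo] --> (1 : R^o) ->
    `|x n + y n| @[n --> \oo] --> (2 : R) ->
    phi n (y n) @[n --> \oo] --> (1 : R^o).

(* Main.v *)
Require Import Defs.
From HB Require Import structures.
From mathcomp Require Import all_boot all_order all_algebra.
From mathcomp Require Import all_classical all_reals all_analysis.
From mathcomp Require Import lra.

Set Implicit Arguments.
Unset Strict Implicit.
Unset Printing Implicit Defensive.

Import Order.TTheory GRing.Theory Num.Theory.
Import numFieldNormedType.Exports.

Local Open Scope classical_set_scope.
Local Open Scope ring_scope.

(** Write [lambda] for the norm of [T].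

    That [lambda] in the spectrum forces [|Id + T| = 1 + lambda] is true in
    every Banach space: if [|Id + T| < 1 + lambda], then
    [lambda Id - T = (1 + lambda) Id - (Id + T)] is a scalar operator minus one
    of smaller norm, hence invertible ([op_invertible_scale_sub]).

    Conversely let [|Id + T| = 1 + lambda] with [lambda > 0], and let
    [S = T / lambda], a contraction.  Convexity of the norm gives unit vectors
    [x] for which [|x + S x|] is close to [2].  Choose a norming functional
    [phi] of [x].  The uacs property, applied to [x], [S x] and [phi], says that
    [phi (S x)] is close to [1]; then [phi \o S] is again an almost norming
    functional of [x] in the dual ball, so the same step applies to it, and
    inductively [phi (S^k x)] is close to [1] for all [k] below any prescribed
    [N] ([uacs_orbit]).  Thus [s = x + S x + ... + S^(N-1) x] has norm at least
    [N / 2], while [s - S s = x - S^N x] has norm at most [2].  As [N] is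
    arbitrary, [Id - S] is not bounded below ([uacs_not_bounded_below]), so
    [lambda Id - T] has no bounded inverse.

    The norming functional requires the Hahn-Banach theorem.  It is obtained
    here from sublinear functionals alone, with no extension from subspaces:
    Zorn's lemma gives a minimal sublinear functional below a given one, and
    minimal sublinear functionals are linear. *)

(** * Sublinear functionals and the Hahn-Banach theorem *)

Section Sublinear.
Variables (R : realType) (V : lmodType R).
Implicit Types (p q : V -> R) (F : set (V -> R)).

Definition sublinear p :=
  (forall x y, p (x + y) <= p x + p y) /\
  (forall t x, 0 <= t -> p (t *: x) = t * p x).

Lemma sublinear0 p : sublinear p -> p 0 = 0.
Proof. by case=> _ pZ; rewrite -(scale0r 0) pZ// mul0r. Qed.

Lemma sublinear_geN p x : sublinear p -> - p (- x) <= p x.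
Proof.
move=> sp; have := sp.1 x (- x).
by rewrite subrr sublinear0// -lerBlDr sub0r.
Qed.

Definition pointwise_inf F (y : V) : R := inf [set f y | f in F].

Lemma pointwise_inf_le F f y :
  has_lbound [set g y | g in F] -> F f -> pointwise_inf F y <= f y.
Proof. by move=> lbF Ff; apply: ge_inf => //; exists f. Qed.

Lemma le_pointwise_inf F a y : F !=set0 ->
  (forall f, F f -> a <= f y) -> a <= pointwise_inf F y.
Proof.
move=> [f Ff] aF; apply: lb_le_inf; first by exists (f y), f.
by move=> _ [g Fg <-]; exact: aF.
Qed.

(** The members of [F] need not be sublinear; only the whole family has to be
    directed well enough.  This covers both the infimum of a chain and the
    infimum defining [tilt], whose members are not homogeneous.  Upper bounds on
    [inf F (t *: x)] suffice for homogeneity, since [t^-1] gives the converse. *)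
Lemma sublinear_pointwise_inf F : F !=set0 ->
  (forall y, has_lbound [set f y | f in F]) ->
  (forall f, F f -> f 0 = 0) ->
  (forall f g, F f -> F g -> forall y z,
    exists2 h, F h & h (y + z) <= f y + g z) ->
  (forall f c, F f -> 0 < c -> forall y,
    exists2 h, F h & h (c *: y) <= c * f y) ->
  sublinear (pointwise_inf F).
Proof.
move=> F0 lbF Fz FD FZ.
have infZ t x : 0 < t -> pointwise_inf F (t *: x) <= t * pointwise_inf F x.
  move=> t0; rewrite -ler_pdivrMl//; apply: le_pointwise_inf => // f Ff.
  have [h Fh hle] := FZ f t Ff t0 x.
  by rewrite ler_pdivrMl// (le_trans _ hle)//; exact: pointwise_inf_le.
split=> [x y|t x].
  rewrite -lerBlDr; apply: le_pointwise_inf => // f Ff.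
  rewrite lerBlDr -lerBlDl; apply: le_pointwise_inf => // g Fg; rewrite lerBlDl.
  have [h Fh hle] := FD f g Ff Fg x y.
  by rewrite (le_trans _ hle)//; exact: pointwise_inf_le.
rewrite le_eqVlt => /predU1P[<-|t0].
  rewrite scale0r mul0r; apply: le_anti; apply/andP; split.
    by have [f Ff] := F0; rewrite -(Fz f Ff); exact: pointwise_inf_le.
  by apply: le_pointwise_inf => // g /Fz ->.
apply/eqP; rewrite eq_le infZ//= -ler_pdivlMl//.
by rewrite -[in leLHS](scalerK (lt0r_neq0 t0) x) infZ// invr_gt0.
Qed.

(** The largest sublinear functional below [p] whose value at [- x] is at most
    [- p x]. *)
Definition tilt p (x y : V) : R :=
  pointwise_inf [set fun z => p (z + t *: x) - t * p x | t in [set t | 0 <= t]] y.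

Lemma tilt_lbound p x y : sublinear p ->
  has_lbound [set f y | f in
    [set fun z => p (z + t *: x) - t * p x | t in [set t | 0 <= t]]].
Proof.
move=> sp; exists (- p (- y)) => _ [_ [t t0 <-] <-].
rewrite lerBrDr -sp.2// addrC lerBlDr.
by rewrite (le_trans _ (sp.1 _ _))// addrAC subrr add0r.
Qed.

Lemma tilt_le p x y t : sublinear p -> 0 <= t ->
  tilt p x y <= p (y + t *: x) - t * p x.
Proof.
move=> sp t0.
apply: (@pointwise_inf_le _ (fun z => p (z + t *: x) - t * p x)).
  exact: tilt_lbound.
by exists t.
Qed.

Lemma sublinear_tilt p x : sublinear p -> sublinear (tilt p x).
Proof.
move=> sp; apply: sublinear_pointwise_inf.
- by exists (fun z => p (z + 0 *: x) - 0 * p x), 0 => /=.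
- by move=> y; exact: tilt_lbound.
- by move=> _ [t t0 <-]; rewrite add0r sp.2// subrr.
- move=> _ _ [t t0 <-] [s s0 <-] y z.
  exists (fun z => p (z + (t + s) *: x) - (t + s) * p x).
    by exists (t + s) => //=; exact: addr_ge0.
  rewrite scalerDl (addrACA y) mulrDl opprD [leRHS]addrACA lerD2r.
  exact: sp.1.
- move=> _ c [t t0 <-] c0 y.
  exists (fun z => p (z + (c * t) *: x) - (c * t) * p x).
    by exists (c * t) => //=; rewrite mulr_ge0// ltW.
  by rewrite -scalerA -scalerDr sp.2 ?(ltW c0)// -mulrA -mulrBr.
Qed.

Definition minimal_sublinear p := sublinear p /\
  forall r, sublinear r -> (forall y, r y <= p y) -> forall y, p y <= r y.

(** Zorn's lemma applies because a sublinear [f] below [q] satisfies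
    [- q (- y) <= f y], so infima of chains stay finite. *)
Lemma exists_minimal_sublinear q : sublinear q ->
  exists2 p, minimal_sublinear p & forall y, p y <= q y.
Proof.
move=> sq; pose T := {p | sublinear p /\ forall y, p y <= q y}.
pose ge (s t : T) := `[< forall y, sval t y <= sval s y >].
pose q0 : T := exist _ q (conj sq (fun y => lexx (q y))).
have [||A Atot|[p [sp pq]] pmin] := @ZL_preorder T q0 ge.
- by move=> t; apply/asboolP.
- move=> t s u /asboolP ts /asboolP tu; apply/asboolP => y.
  exact: le_trans (tu y) (ts y).
- have [A0|/set0P[t0 At0]] := eqVneq A set0.
    by exists q0 => s; rewrite A0.
  pose F := [set sval s | s in A].
  have F0 : F !=set0 by exists (sval t0), t0.
  have lbF y : has_lbound [set f y | f in F].
    exists (- q (- y)) => _ [_ [[f [sf fq]] _ <-] <-] /=.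
    by rewrite (le_trans _ (sublinear_geN y sf))// lerN2.
  have sF : sublinear (pointwise_inf F).
    apply: sublinear_pointwise_inf => //.
    + by move=> _ [[f [sf fq]] _ <-]; exact: sublinear0.
    + move=> _ _ [s As <-] [t At <-] y z.
      have [/asboolP st|/asboolP ts] := Atot _ _ As At.
        exists (sval t); first by exists t.
        by rewrite (le_trans ((svalP t).1.1 y z))// lerD2r.
      exists (sval s); first by exists s.
      by rewrite (le_trans ((svalP s).1.1 y z))// lerD2l.
    + move=> _ c [[f [sf fq]] As <-] c0 y.
      exists f; first by exists (exist _ f (conj sf fq)).
      by rewrite sf.2// ltW.
  have Fq y : pointwise_inf F y <= q y.
    apply: le_trans ((svalP t0).2 y); apply: pointwise_inf_le => //.
    by exists t0.
  exists (exist _ (pointwise_inf F) (conj sF Fq)) => s As; apply/asboolP => y /=.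
  by apply: pointwise_inf_le => //; exists s.
- exists p => //; split=> // r sr rp.
  have rq y : r y <= q y := le_trans (rp y) (pq y).
  have /asboolP := pmin (exist _ r (conj sr rq)) (asboolT rp).
  exact.
Qed.

(** By minimality [p] coincides with each of its tilts, so that
    [p (- x) = - p x] for every [x]; an odd sublinear functional is linear. *)
Lemma minimal_sublinear_linear p : minimal_sublinear p ->
  exists f : {linear V -> R^o}, forall x, f x = p x.
Proof.
move=> [sp pmin].
have pN x : p (- x) = - p x.
  apply: le_anti; apply/andP; split; last by rewrite lerNl sublinear_geN.
  have lep y : tilt p x y <= p y.
    by rewrite (le_trans (tilt_le x y sp (lexx 0)))// scale0r mul0r addr0 subr0.
  rewrite (le_trans (pmin _ (sublinear_tilt x sp) lep _))//.
  rewrite (le_trans (tilt_le _ _ sp ler01))// scale1r mul1r addNr.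
  by rewrite sublinear0// sub0r.
have pD x y : p (x + y) = p x + p y.
  apply: le_anti; rewrite sp.1/= -lerBrDr -pN.
  by rewrite (le_trans _ (sp.1 _ _))// addrK.
have pZ : linear (p : V -> R^o).
  move=> a x y; rewrite pD; congr (_ + _).
  have [a0|a0] := leP 0 a; first exact: sp.2.
  by rewrite -[a]opprK scaleNr pN sp.2 ?oppr_ge0 ?ltW// scaleNr.
pose pL := GRing.isLinear.Build _ _ _ _ (p : V -> R^o) pZ.
pose f : {linear V -> R^o} := HB.pack (p : V -> R^o) pL.
by exists f.
Qed.

Theorem sublinear_dominates_linear q : sublinear q ->
  exists f : {linear V -> R^o}, forall x, f x <= q x.
Proof.
move=> /exists_minimal_sublinear[p /minimal_sublinear_linear[f fp] pq].
by exists f => x; rewrite fp.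
Qed.

End Sublinear.

(** A linear functional below the tilt of the norm along [x] is below the norm
    and takes a value at most [- `|x|] at [- x]. *)
Lemma norming_functional (R : realType) (X : normedModType R) (x : X) :
  exists2 f : {linear X -> R^o}, (forall y, `|f y| <= `|y|) & f x = `|x|.
Proof.
have sN : sublinear (fun y : X => `|y|).
  split=> [y z|t y t0]; first exact: ler_normD.
  by rewrite normrZ ger0_norm.
have [f ft] := sublinear_dominates_linear (sublinear_tilt x sN).
have fN y : f y <= `|y|.
  apply: le_trans (ft y) _; apply: le_trans (tilt_le x y sN (lexx 0)) _.
  by rewrite scale0r mul0r addr0 subr0.
exists f => [y|].
  by rewrite ler_norml fN andbT lerNl -linearN -(normrN y).
apply: le_anti; rewrite fN/= -lerN2 -linearN.
apply: le_trans (ft _) _; apply: le_trans (tilt_le _ _ sN ler01) _.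
by rewrite scale1r mul1r addNr normr0 sub0r.
Qed.

(** * The operator norm *)

Section OperatorNorm.
Variables (R : realType) (V W : normedModType R).
Implicit Types f : {linear V -> W}.

Lemma bounded_fun_norm_of_le f M :
  (forall x, `|f x| <= M * `|x|) -> bounded_fun_norm f.
Proof.
move=> fM r; exists (`|M| * r) => x xr; rewrite (le_trans (fM x))//.
apply: le_trans (ler_wpM2l (normr_ge0 M) xr).
by rewrite ler_wpM2r// ler_norm.
Qed.

Lemma opnorm_le f M : 0 <= M ->
  (forall x, `|f x| <= M * `|x|) -> opnorm f <= M.
Proof.
move=> M0 fM; apply: ge_sup; first by exists `|f 0|, 0 => //=; rewrite normr0.
by move=> _ [x /= x1 <-]; rewrite (le_trans (fM x))// ler_piMr.
Qed.

Lemma opnorm_has_sup f : bounded_fun_norm f ->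
  has_sup [set `|f x| | x in [set x : V | `|x| <= 1]].
Proof.
move=> bf; split; first by exists `|f 0|, 0 => //=; rewrite normr0.
by have [M fM] := bf 1; exists M => _ [x /= x1 <-]; exact: fM.
Qed.

Lemma le_opnorm f x : bounded_fun_norm f -> `|f x| <= opnorm f * `|x|.
Proof.
move=> bf; have [->|x0] := eqVneq x 0; first by rewrite linear0 !normr0 mulr0.
have x0' : 0 < `|x| by rewrite normr_gt0.
rewrite -ler_pdivrMr//; apply: ub_le_sup; first exact: (opnorm_has_sup bf).2.
exists (`|x|^-1 *: x) => /=.
  by rewrite normrZ normfV normr_id mulVf ?gt_eqF.
by rewrite linearZ/= normrZ normfV normr_id mulrC.
Qed.

Lemma opnorm_ge0 f : bounded_fun_norm f -> 0 <= opnorm f.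
Proof.
move=> bf; apply: ub_le_sup; first exact: (opnorm_has_sup bf).2.
by exists 0 => /=; rewrite ?linear0 normr0.
Qed.

(** The bound [e <= opnorm f] makes the almost maximizing vector of the ball
    nonzero, so that it can be rescaled to the sphere. *)
Lemma opnorm_almost_attained f e : bounded_fun_norm f -> 0 < e <= opnorm f ->
  exists2 x, `|x| = 1 & opnorm f - e < `|f x|.
Proof.
move=> bf /andP[e0 ef].
have [_ [x /= x1 <-] fx] := sup_adherent e0 (opnorm_has_sup bf).
have {}fx : opnorm f - e < `|f x| by [].
have fx0 : 0 < `|f x| by apply: le_lt_trans fx; rewrite subr_ge0.
have x0 : 0 < `|x|.
  by rewrite normr_gt0; apply: contraTneq fx0 => ->; rewrite linear0 normr0 ltxx.
exists (`|x|^-1 *: x); first by rewrite normrZ normfV normr_id mulVf ?gt_eqF.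
rewrite (lt_le_trans fx)// linearZ/= normrZ normfV normr_id ler_peMl//.
by rewrite invf_ge1.
Qed.

Lemma opnorm_normalize f : bounded_fun_norm f -> 0 < opnorm f ->
  bounded_fun_norm ((opnorm f)^-1 \*: f) /\ opnorm ((opnorm f)^-1 \*: f) = 1.
Proof.
move=> bf f0; have le1 x : `|((opnorm f)^-1 \*: f) x| <= 1 * `|x|.
  by rewrite /= normrZ gtr0_norm ?invr_gt0// mul1r ler_pdivrMl// le_opnorm.
have bg : bounded_fun_norm ((opnorm f)^-1 \*: f).
  exact: bounded_fun_norm_of_le le1.
split=> //; apply: le_anti; rewrite opnorm_le//=.
rewrite -(ler_pM2l f0) mulr1; apply: opnorm_le.
  by rewrite mulr_ge0 ?opnorm_ge0.
move=> x; have := le_opnorm x bg; rewrite /= normrZ gtr0_norm ?invr_gt0//.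
by rewrite ler_pdivrMl// mulrA.
Qed.

End OperatorNorm.

(** Solving [mu *: x - A x = y] means finding a fixed point of the contraction
    [x |-> mu^-1 *: (y + A x)].  The lower bound [(mu - q) * `|x|] on the norm
    of [mu *: x - A x] gives uniqueness, hence linearity of the solution map,
    and also its boundedness. *)
Lemma op_invertible_scale_sub (R : realType) (X : completeNormedModType R)
    (A : {linear X -> X}) (mu q : R) : 0 <= q -> q < mu ->
  (forall x, `|A x| <= q * `|x|) -> op_invertible (fun x => mu *: x - A x).
Proof.
move=> q0 qmu Aq; have mu0 : 0 < mu := le_lt_trans q0 qmu.
have dmu : 0 < mu - q by rewrite subr_gt0.
pose B : {linear X -> X} := mu \*: idfun \- A.
have BE x : B x = mu *: x - A x by [].
have below x : (mu - q) * `|x| <= `|B x|.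
  rewrite (le_trans _ (lerB_dist _ _))//= normrZ gtr0_norm// mulrBl.
  by rewrite lerD2l lerN2.
have inj : injective B.
  move=> x y xy; have := below (x - y); rewrite linearB xy subrr normr0.
  by rewrite pmulr_rle0// normr_le0 subr_eq0 => /eqP.
have surj y : exists x, B x = y.
  pose f : {fun [set: X] >-> [set: X]} :=
    totalfun_ setT (fun x => mu^-1 *: (y + A x)).
  have q1 : 0 <= q / mu by rewrite divr_ge0 // ltW.
  have cf : is_contraction f.
    exists (NngNum q1); split => /=; first by rewrite ltr_pdivrMr// mul1r.
    move=> [u v] _ /=.
    change (`|mu^-1 *: (y + A u) - mu^-1 *: (y + A v)| <= q / mu * `|u - v|).
    rewrite -scalerBr [y + A u]addrC addrKA -linearB.
    rewrite normrZ gtr0_norm ?invr_gt0//.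
    by rewrite [q / mu]mulrC -mulrA ler_pM2l ?invr_gt0.
  have [x _ xf] := banach_fixed_point cf closedT (ex_intro _ 0 I).
  have {}xf : x = mu^-1 *: (y + A x) := xf.
  by exists x; rewrite BE {1}xf scalerA divff ?gt_eqF// scale1r addrK.
have [S HS] := choice surj.
have linS : linear S by move=> a u v; apply: inj; rewrite linearP !HS.
pose SL := GRing.isLinear.Build _ _ _ _ S linS.
pose L : {linear X -> X} := HB.pack S SL.
exists L; split=> [|x|y].
- apply: (@bounded_fun_norm_of_le _ _ _ _ (mu - q)^-1) => y.
  by rewrite mulrC ler_pdivlMr// mulrC -[in leRHS](HS y).
- by apply: inj; rewrite HS.
- exact: HS.
Qed.

(** * Uniform form of the uacs property *)

Lemma cvg_harmonic_below (R : realType) (u : nat -> R) (l : R) :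
  (forall n, l - n.+1%:R^-1 < u n) -> (forall n, u n <= l) ->
  u n @[n --> \oo] --> l.
Proof.
move=> lu ul; apply: (@squeeze_cvgr _ _ _ _ (fun n => l - harmonic n) (cst l)).
- by apply: nearW => n /=; rewrite ul andbT; exact/ltW/lu.
- rewrite -[X in _ --> X]subr0.
  by apply: cvgB; [exact: cvg_cst|exact: cvg_harmonic].
- exact: cvg_cst.
Qed.

Lemma uacs_eps_delta (R : realType) (X : normedModType R) (e : R) :
  uacs X -> 0 < e -> exists2 d, 0 < d &
    forall (x y : X) (phi : {linear X -> R^o}), unit_sphere x -> unit_sphere y ->
      dual_unit_sphere phi -> 1 - d < phi x -> 2 - d < `|x + y| ->
      1 - e < phi y.
Proof.
move=> hX e0; apply: contrapT => H.
have : forall n, exists t : X * X * {linear X -> R^o},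
   [/\ unit_sphere t.1.1, unit_sphere t.1.2, dual_unit_sphere t.2 &
    [/\ 1 - n.+1%:R^-1 < t.2 t.1.1, 2 - n.+1%:R^-1 < `|t.1.1 + t.1.2| &
     t.2 t.1.2 <= 1 - e]].
  move=> n; apply: contrapT => Hn; apply: H; exists n.+1%:R^-1 => // x y phi.
  move=> sx sy sphi phix xy; rewrite ltNge; apply/negP => phiy.
  by apply: Hn; exists (x, y, phi).
move=> /choice[t Ht].
have sx n : unit_sphere (t n).1.1 by case: (Ht n).
have sy n : unit_sphere (t n).1.2 by case: (Ht n).
have sphi n : dual_unit_sphere (t n).2 by case: (Ht n).
have cx : (t n).2 (t n).1.1 @[n --> \oo] --> (1 : R^o).
  apply: cvg_harmonic_below => n; first by case: (Ht n) => _ _ _ [].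
  have [bphi phi1] := sphi n.
  rewrite (le_trans (ler_norm _))// (le_trans (le_opnorm _ bphi))//.
  by rewrite phi1 (sx n) mulr1.
have cxy : `|(t n).1.1 + (t n).1.2| @[n --> \oo] --> (2 : R).
  apply: cvg_harmonic_below => n; first by case: (Ht n) => _ _ _ [].
  by rewrite (le_trans (ler_normD _ _))// (sx n) (sy n).
have := hX _ _ _ sx sy sphi cx cxy.
move=> /cvgrPdist_lt/(_ e e0)[N _ /(_ N (leqnn N))] /=.
have [_ _ _ [_ _ phiy]] := Ht N.
by move=> /(le_lt_trans (ler_norm _)); lra.
Qed.

(** Iterating the property produces vectors [S x] and functionals [phi \o S]
    that lie only in the unit balls.  When they almost satisfy the two
    hypotheses their norms are nearly [1], so normalizing them changes all
    quantities little. *)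
Lemma uacs_eps_delta_ball (R : realType) (X : normedModType R) (e : R) :
  uacs X -> 0 < e -> exists2 d, 0 < d &
    forall (x y : X) (phi : {linear X -> R^o}), `|x| = 1 -> `|y| <= 1 ->
      (forall z, `|phi z| <= `|z|) -> 1 - d < phi x -> 2 - d < `|x + y| ->
      1 - e < phi y.
Proof.
move=> hX; wlog e1 : e / e <= 1 => [wlg|] e0.
  have m0 : 0 < Num.min e 1 by rewrite lt_min e0 ltr01.
  have [||d d0 H] := wlg (Num.min e 1) => //; first by rewrite ge_min lexx orbT.
  exists d => // x y phi x1 y1 phi1 phix xy.
  apply: le_lt_trans (H x y phi x1 y1 phi1 phix xy).
  by rewrite lerD2l lerN2 ge_min lexx.
have e3 : 0 < e / 3 by rewrite divr_gt0.
have [d d0 H] := uacs_eps_delta hX e3.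
(* Normalizing [y] costs another [m] in [`|x + y|], whence [d / 2].  Undoing the
   two normalizations multiplies by at least [(1 - m) ^ 2], whence [e / 3]. *)
have m0 : 0 < Num.min (d / 2) (e / 3) by rewrite lt_min divr_gt0.
exists (Num.min (d / 2) (e / 3)) => // x y phi x1 y1 phi1.
set m := Num.min _ _ in m0 * => phix xy.
have md : m <= d / 2 by rewrite ge_min lexx.
have me : m <= e / 3 by rewrite ge_min lexx orbT.
have ley : 1 - m < `|y|.
  have := ler_normD x y; rewrite x1; lra.
have y0 : 0 < `|y| by lra.
have phi1' z : `|phi z| <= 1 * `|z| by rewrite mul1r.
have bphi : bounded_fun_norm phi := bounded_fun_norm_of_le phi1'.
have c1 : opnorm phi <= 1 by apply: opnorm_le.
have ltc : 1 - m < opnorm phi.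
  apply: lt_le_trans phix _; rewrite (le_trans (ler_norm _))//.
  by rewrite (le_trans (le_opnorm _ bphi))// x1 mulr1.
have c0 : 0 < opnorm phi by lra.
have Hy : 1 - e / 3 < ((opnorm phi)^-1 \*: phi) (`|y|^-1 *: y).
  apply: (H x) => //.
  - by rewrite /unit_sphere /= normrZ normfV normr_id mulVf ?gt_eqF.
  - exact: opnorm_normalize.
  - rewrite /=; apply: (@lt_le_trans _ _ (phi x)); first by lra.
    by rewrite ler_peMl ?invf_ge1//; lra.
  - have -> : x + `|y|^-1 *: y = (x + y) + (`|y|^-1 - 1) *: y.
      by rewrite scalerBl scale1r addrACA subrr addr0.
    apply: lt_le_trans (lerB_normD _ _).
    rewrite normrZ ger0_norm ?subr_ge0 ?invf_ge1//.
    rewrite mulrBl mulVf ?gt_eqF// mul1r; lra.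
have phiE : ((opnorm phi)^-1 \*: phi) (`|y|^-1 *: y) =
    (opnorm phi * `|y|)^-1 * phi y by rewrite invfM -mulrA /= linearZ.
move: Hy; rewrite phiE.
rewrite ltr_pdivlMl ?mulr_gt0//; apply: le_lt_trans.
move: c1 ltc y1 ley; set c := opnorm phi; set n := `|y| => c1 ltc y1 ley.
have cn : 1 - 2 * m <= c * n by nra.
have cne : 1 - 2 * (e / 3) <= c * n by lra.
nra.
Qed.

(** * Orbits of a contraction on a uacs space *)

Section ContractionsOfUacsSpaces.
Variables (R : realType) (X : normedModType R) (S : {linear X -> X}).
Hypotheses (hX : uacs X) (S1 : forall z, `|S z| <= `|z|).

(** The bound for [k.+1] is the one for [k] applied to [phi \o S], which the
    uacs property shows to be almost norming at [x]; this is where the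
    alternation between vectors and functionals is used. *)
Lemma uacs_orbit (k : nat) (e : R) : 0 < e -> exists2 d, 0 < d &
  forall (x : X) (phi : {linear X -> R^o}), `|x| = 1 ->
    (forall z, `|phi z| <= `|z|) -> 1 - d < phi x -> 2 - d < `|x + S x| ->
    1 - e < phi (iter k S x).
Proof.
elim: k e => [|k IHk] e e0; first by exists e.
have [d d0 Hd] := IHk e e0.
have [d' d'0 Hd'] := uacs_eps_delta_ball hX d0.
have m0 : 0 < Num.min d d' by rewrite lt_min d0.
exists (Num.min d d') => // x phi x1 phi1 phix xS.
have [md md'] : Num.min d d' <= d /\ Num.min d d' <= d'.
  by rewrite !ge_min !lexx orbT.
apply: (Hd x (phi \o S)) => //=.
- by move=> z; exact: le_trans (phi1 _) (S1 _).
- by apply: (Hd' x) => //; [rewrite -x1|lra|lra].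
- by lra.
Qed.

Lemma uacs_orbit_sum (N : nat) : exists2 d, 0 < d &
  forall (x : X) (phi : {linear X -> R^o}), `|x| = 1 ->
    (forall z, `|phi z| <= `|z|) -> 1 - d < phi x -> 2 - d < `|x + S x| ->
    N%:R / 2 <= phi (\sum_(k < N) iter k S x).
Proof.
elim: N => [|N [d d0 Hd]].
  by exists 1 => // x phi _ _ _ _; rewrite mul0r big_ord0 linear0.
have [d' d'0 Hd'] := @uacs_orbit N (1 / 2) ltac:(by rewrite divr_gt0).
exists (Num.min d d'); first by rewrite lt_min d0.
move=> x phi x1 phi1 phix xS.
have [md md'] : Num.min d d' <= d /\ Num.min d d' <= d'.
  by rewrite !ge_min !lexx orbT.
rewrite big_ord_recr/= linearD.
have lt_new := Hd' x phi x1 phi1 ltac:(by lra) ltac:(by lra).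
have le_old := Hd x phi x1 phi1 ltac:(by lra) ltac:(by lra).
rewrite -natr1 mulrDl; apply: lerD => //.
by apply: ltW; apply: le_lt_trans lt_new; lra.
Qed.

Lemma orbit_sum_telescope (x : X) (N : nat) :
  let s := \sum_(k < N) iter k S x in s - S s = x - iter N S x.
Proof.
elim: N => [|N /= IHN] /=; first by rewrite big_ord0 linear0 !subrr.
by rewrite big_ord_recr/= linearD/= opprD addrACA IHN addrA subrK.
Qed.

Lemma iter_contraction_le (x : X) (N : nat) : `|iter N S x| <= `|x|.
Proof. by elim: N => [|N IHN] //=; exact: le_trans (S1 _) IHN. Qed.

(** The sum [s] of the first [N] terms of the orbit of [x] has norm at least
    [N / 2], whereas [s - S s] telescopes to a vector of norm at most [2]. *)
Lemma uacs_not_bounded_below :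
  (forall d, 0 < d -> exists2 x, `|x| = 1 & 2 - d < `|x + S x|) ->
  forall C, ~ forall x, `|x| <= C * `|x - S x|.
Proof.
move=> almost2 C belowC; pose N := (Num.truncn (4 * `|C|)).+1.
have ltN : 4 * `|C| < N%:R by exact: Num.Theory.truncnS_gt.
have [d d0 Hd] := uacs_orbit_sum N.
have [x x1 xS] := almost2 d d0.
have [phi phi1 phix] := norming_functional x.
have := Hd x phi x1 phi1 ltac:(by rewrite phix x1 gtrBl) xS.
set s := \sum_(k < N) _ => phis.
have sC : `|s| <= `|C| * 2.
  rewrite (le_trans (belowC s))//.
  have -> : s - S s = x - iter N S x by exact: orbit_sum_telescope.
  rewrite (le_trans (ler_wpM2r _ (ler_norm C)))// ler_wpM2l//.
  by rewrite (le_trans (ler_normB _ _))// x1 lerD2l -x1 iter_contraction_le.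
have := le_trans (ler_norm _) (phi1 s); lra.
Qed.

End ContractionsOfUacsSpaces.

(** * The two implications of the anti-Daugavet property *)

(** If [opnorm (Id + T)] were less than [1 + opnorm T], then
    [opnorm T *: Id - T = (1 + opnorm T) *: Id - (Id + T)] would be
    invertible. *)
Lemma opnorm_id_add_of_spectrum (R : realType) (X : completeNormedModType R)
    (T : {linear X -> X}) : bounded_fun_norm T ->
  spectrum T (opnorm T) -> opnorm (fun x => x + T x) = 1 + opnorm T.
Proof.
move=> bT; apply: contra_notP => /eqP neq; have T0 := opnorm_ge0 bT.
pose A : {linear X -> X} := idfun \+ T.
have leA x : `|A x| <= (1 + opnorm T) * `|x|.
  by rewrite (le_trans (ler_normD _ _))// mulrDl mul1r lerD2l le_opnorm.
have bA : bounded_fun_norm A := bounded_fun_norm_of_le leA.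
have ltA : opnorm A < 1 + opnorm T.
  by rewrite lt_neqAle neq/= opnorm_le// addr_ge0.
have [S [bS AK SK]] := op_invertible_scale_sub (opnorm_ge0 bA) ltA
  (fun x => le_opnorm x bA).
have E x : (1 + opnorm T) *: x - A x = opnorm T *: x - T x.
  by rewrite scalerDl scale1r/= opprD addrACA subrr add0r.
by exists S; split=> // x; rewrite -E// AK.
Qed.

(** A bounded inverse of [lam *: Id - T] would make [Id - lam^-1 *: T] bounded
    below. *)
Lemma uacs_spectrum_of_opnorm_id_add (R : realType) (X : normedModType R)
    (T : {linear X -> X}) : uacs X -> bounded_fun_norm T ->
  opnorm (fun x => x + T x) = 1 + opnorm T -> spectrum T (opnorm T).
Proof.
move=> hX bT normA [V [bV VK _]]; have := opnorm_ge0 bT.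
pose A : {linear X -> X} := idfun \+ T.
have {}normA : opnorm A = 1 + opnorm T := normA.
have leA x : `|A x| <= (1 + opnorm T) * `|x|.
  by rewrite (le_trans (ler_normD _ _))// mulrDl mul1r lerD2l le_opnorm.
have bA : bounded_fun_norm A := bounded_fun_norm_of_le leA.
have leT x := le_opnorm x bT.
move: normA leT VK; set lam := opnorm T => normA leT VK.
have VB x : `|x| <= opnorm V * `|lam *: x - T x|.
  by rewrite -{1}(VK x); exact: le_opnorm.
have approx e : 0 < e <= 1 + lam ->
    exists2 x, `|x| = 1 & 1 + lam - e < `|x + T x|.
  by rewrite -normA => /(opnorm_almost_attained bA).
rewrite le_eqVlt => /predU1P[lam0|lam0].
  (* Here [T = 0], and a unit vector exists because [Id + T] has norm 1. *)
  have [|x x1 _] := approx 1; first by rewrite -lam0 addr0 ltr01 lexx.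
  have := VB x; have := leT x; rewrite -lam0 mul0r scale0r normr_le0 => /eqP ->.
  by rewrite subrr normr0 mulr0 x1 ler10.
pose S : {linear X -> X} := lam^-1 \*: T.
have S1 z : `|S z| <= `|z|.
  by rewrite /= normrZ gtr0_norm ?invr_gt0// ler_pdivrMl.
have TS x : T x = lam *: S x by rewrite /= scalerA divff ?scale1r// gt_eqF.
apply: (@uacs_not_bounded_below _ _ S hX S1 _ (opnorm V * lam)).
  (* Whichever of [1] and [lam] is larger, subtracting the excess multiple of
     [x] or of [S x] from [x + lam *: S x] leaves [Num.min 1 lam] times
     [x + S x]; this explains the factor in [e].  The cap at [1] ensures
     [e <= 1 + lam]. *)
  move=> d d0; pose e := Num.min 1 (d * Num.min 1 lam).
  have m0 : 0 < Num.min 1 lam by rewrite lt_min ltr01.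
  have e0 : 0 < e by rewrite lt_min ltr01 mulr_gt0.
  have ed : e <= d * Num.min 1 lam by rewrite ge_min lexx orbT.
  have e1 : e <= 1 by rewrite ge_min lexx.
  have [|x x1 xT] := approx e; first by rewrite e0/= (le_trans e1)// lerDl ltW.
  exists x => //.
  have {}xT : 1 + lam - e < `|x + lam *: S x| by rewrite -TS.
  have := S1 x; rewrite x1 => Sx1.
  have [lam1|lam1] := leP lam 1.
    have mlam : Num.min 1 lam = lam by apply/min_idPr.
    have : `|x + lam *: S x| <= (1 - lam) + lam * `|x + S x|.
      have -> : x + lam *: S x = (1 - lam) *: x + lam *: (x + S x).
        by rewrite scalerBl scale1r scalerDr addrA subrK.
      rewrite (le_trans (ler_normD _ _))// !normrZ x1 mulr1 (gtr0_norm lam0).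
      by rewrite ger0_norm ?subr_ge0.
    by rewrite mlam in ed; nra.
  have mlam : Num.min 1 lam = 1 by apply/min_idPl/ltW.
  have : `|x + lam *: S x| <= `|x + S x| + (lam - 1) * `|S x|.
    have -> : x + lam *: S x = (x + S x) + (lam - 1) *: S x.
      by rewrite scalerBl scale1r addrACA subrr addr0.
    rewrite (le_trans (ler_normD _ _))// normrZ.
    by rewrite ger0_norm ?subr_ge0// ltW.
  by rewrite mlam mulr1 in ed; nra.
move=> x; rewrite (le_trans (VB x))// TS -scalerBr normrZ gtr0_norm//.
by rewrite mulrA.
Qed.

Theorem theorem4p5 (R : realType) (X : completeNormedModType R) (hX : uacs X) :
  anti_Daugavet X.
Proof.
move=> T bT; split; first exact: uacs_spectrum_of_opnorm_id_add.
exact: opnorm_id_add_of_spectrum.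
Qed.
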